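(* Let $G$ be a finite group and let $p$ be a prime divisor of $|G|$ with $(|G|,(p-1)(p^2-1)\cdots(p^n-1))=1$ for some integer $n\geq 1$. Then $G$ is $p$-nilpotent if and only if there exists a normal subgroup $H$ of $G$ such that $G/H$ is $p$-nilpotent and, for any Sylow $p$-subgroup $P$ of $H$, every subgroup $L$ of $P\cap G^{\mathfrak{N}_{\mathfrak{p}}}$ of order $p^n$ or of order $4$ (the latter when $p=2$, $n=1$, $P$ is non-abelian, and $L$ is cyclic) not contained in $Z_{\infty}(G)$ (if any exists) either has a $p$-nilpotent supplement in $G$ or satisfies $(\triangle)$ in $G$.
   Context: All groups are finite. $(a,b)$ denotes the greatest common divisor of integers $a,b$. A group is $p$-nilpotent if it has a normal $p$-complement; $G^{\mathfrak{N}_{\mathfrak{p}}}$ is the $p$-nilpotent residual of $G$, i.e. the smallest normal subgroup $R$ of $G$ such that $G/R$ is $p$-nilpotent. $Z_\infty(G)$ is the hypercenter of $G$ (the $\mathfrak{F}$-hypercenter for $\mathfrak{F}=\mathfrak{N}$ the class of nilpotent groups, i.e. the last term of the upper central series). A supplement of a subgroup $L$ in $G$ is a subgroup $T\leq G$ with $G=LT$. ''Either ... or'' is inclusive. Let $L\leq G$. Two subgroups $A,B$ permute if $AB=BA$. - $L$ is S-quasinormal in $G$ if $L$ permutes with every Sylow subgroup of $G$. - $L$ is S-quasinormally embedded in $G$ if every Sylow subgroup of $L$ is a Sylow subgroup of some S-quasinormal subgroup of $G$. - $L$ is $\tau$-quasinormal in $G$ if $L$ permutes with all Sylow $q$-subgroups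 $Q$ of $G$ (for all primes $q$) such that $(q,|L|)=1$ and $(|L|,|Q^G|)\neq 1$, where $Q^G$ is the normal closure of $Q$ in $G$. - $L_{seG}$ is the subgroup generated by all subgroups of $L$ which are S-quasinormally embedded in $G$; $L_{\tau G}$ is the subgroup generated by all subgroups of $L$ which are $\tau$-quasinormal in $G$. - $L$ is weakly S-embedded in $G$ if there is $K\unlhd G$ such that $LK$ is S-quasinormal in $G$ and $L\cap K\leq L_{seG}$. - $L$ is weakly $\tau$-embedded in $G$ if there is $K\unlhd G$ such that $LK$ is S-quasinormal in $G$ and $L\cap K\leq L_{\tau G}$. - $L$ satisfies $(\triangle)$ in $G$ if $L$ is weakly S-embedded or weakly $\tau$-embedded in $G$. *)

(* Defs.v *)
From mathcomp Require Import all_boot all_fingroup all_solvable.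

Set Implicit Arguments.
Unset Strict Implicit.
Unset Printing Implicit Defensive.

Local Open Scope group_scope.

Section Definitions.

Variable gT : finGroupType.
Implicit Types (A B L : {set gT}) (G : {set gT}).

Definition p_nilpotent (p : nat) G :=
  [exists N : {group gT}, (N <| G) && p^'.-Hall(G) N].

Definition permutes A B := A * B == B * A.

Definition normal_closure A G := <<class_support A G>>.

(* The library's [Sylow G Q] says that Q is a Sylow q-subgroup of G for some
   prime q, see SylowP. *)
Definition S_quasinormal L G :=
  (L \subset G) && [forall (Q : {group gT} | Sylow G Q), permutes L Q].

Definition S_quasinormally_embedded L G :=
  (L \subset G) &&
  [forall (Q : {group gT} | Sylow L Q),
    [exists M : {group gT}, S_quasinormal M G && Sylow M Q]].

(* Primes q not dividing #|G| impose no condition: then Q, hence its normal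
   closure, is trivial (see tau_quasinormalP). *)
Definition tau_quasinormal L G :=
  (L \subset G) &&
  all (fun q => [forall (Q : {group gT} | q.-Sylow(G) Q),
         coprime q #|L| && ~~ coprime #|L| #|normal_closure Q G|
           ==> permutes L Q])
      (primes #|G|).

Definition seG L G :=
  <<\bigcup_(A : {group gT} | (A \subset L) && S_quasinormally_embedded A G) A>>.

Definition tauG L G :=
  <<\bigcup_(A : {group gT} | (A \subset L) && tau_quasinormal A G) A>>.

Definition weakly_S_embedded L G :=
  (L \subset G) &&
  [exists K : {group gT},
    [&& K <| G, S_quasinormal (L * K) G & L :&: K \subset seG L G]].

Definition weakly_tau_embedded L G :=
  (L \subset G) &&
  [exists K : {group gT},
    [&& K <| G, S_quasinormal (L * K) G & L :&: K \subset tauG L G]].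

Definition triangle L G := weakly_S_embedded L G || weakly_tau_embedded L G.

Definition has_p_nilpotent_supplement (p : nat) L G :=
  [exists T : {group gT},
    [&& T \subset G, L * T == G & p_nilpotent p T]].

(* The upper central series is stationary from index #|G| on
   (see hypercenter_max). *)
Definition hypercenter G := 'Z_(#|G|)(G).

End Definitions.

(* The smallest normal subgroup of G with p-nilpotent quotient, see
   p_nilpotent_residualP and p_nilpotent_residual_min. *)
Definition p_nilpotent_residual (gT : finGroupType) (p : nat) (G : {set gT}) :=
  \bigcap_(N : {group gT} | (N <| G) && p_nilpotent p (G / N)) N.

Lemma tau_quasinormalP (gT : finGroupType) (L G : {group gT}) :
  reflect (L \subset G /\
           forall (q : nat) (Q : {group gT}), prime q -> q.-Sylow(G) Q ->
             coprime q #|L| -> ~~ coprime #|L| #|normal_closure Q G| ->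
             permutes L Q)
          (tau_quasinormal L G).
Proof.
apply: (iffP andP) => [][sLG H]; split=> //.
  move=> q Q pr_q sylQ co_qL nco.
  have [qG|qG] := boolP (q \in primes #|G|).
    move/allP/(_ q qG)/forall_inP/(_ Q sylQ)/implyP: H; apply.
    by rewrite co_qL.
  have Q1 : Q :=: 1.
    apply/eqP; rewrite trivg_card1 (card_Hall sylQ) p_part.
      by move: qG; rewrite -logn_gt0 -eqn0Ngt => /eqP->.
  by rewrite /permutes Q1 mulg1 mul1g.
apply/allP=> q; rewrite mem_primes => /andP[pr_q _].
apply/forall_inP=> Q sylQ; apply/implyP=> /andP[]; exact: H sylQ.
Qed.

Lemma hypercenter_max (gT : finGroupType) (G : {group gT}) n :
  'Z_n(G) \subset hypercenter G.
Proof.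
have stepE k : 'Z_k.+1(G) = coset 'Z_k(G) @*^-1 'Z(G / 'Z_k(G)) by [].
have stat k : 'Z_k.+1(G) = 'Z_k(G) -> forall m, 'Z_(m + k)(G) = 'Z_k(G).
  by move=> eqk; elim=> // m IHm; rewrite addSn stepE IHm -stepE.
have grow k : (exists2 j, j <= k & 'Z_j.+1(G) = 'Z_j(G)) \/ k < #|'Z_k(G)|.
  elim: k => [|k [[j lejk eqj]|IHk]]; first by right; rewrite cardG_gt0.
    by left; exists j; first exact: leqW.
  have [eqk|neqk] := eqVneq 'Z_k.+1(G) 'Z_k(G); first by left; exists k.
  right; apply: (leq_ltn_trans IHk); apply: proper_card.
  by rewrite properEneq eq_sym neqk ucn_subS.
have [[j lej eqj]|] := grow #|G|; last by rewrite ltnNge subset_leq_card ?ucn_sub.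
have -> : hypercenter G = 'Z_j(G) by rewrite /hypercenter -(subnK lej) stat.
have [lenj|ltjn] := leqP n j; first exact: ucn_sub_geq.
by rewrite -(subnK (ltnW ltjn)) stat.
Qed.

Section Residual.

Variables (gT : finGroupType) (p : nat).
Implicit Types G N M : {group gT}.

Lemma p_nilpotent_quotientP G N : N <| G ->
  reflect (exists2 M : {group gT}, (N \subset M) && (M <| G)
             & p^'.-nat #|M : N| && p.-nat #|G : M|)
          (p_nilpotent p (G / N)).
Proof.
move=> nNG; apply: (iffP existsP) => [[K /andP[nKG hallK]]|[M]].
  have [M defK sNM nMG] := inv_quotientN nNG nKG.
  exists M; first by rewrite sNM.
  have nNM := normalS sNM (normal_sub nMG) nNG.
  case/and3P: hallK => _; rewrite defK /pgroup card_quotient ?normal_norm // => -> /=.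
  rewrite pnatNK index_quotient_eq ?(normal_sub nMG) ?normal_norm //.
  by rewrite subIset ?sNM ?orbT.
case/andP=> sNM nMG /andP[p'M pM]; exists (M / N)%G.
have nNM := normalS sNM (normal_sub nMG) nNG.
rewrite quotient_normal //= /pHall quotientS ?normal_sub //= /pgroup.
rewrite card_quotient ?normal_norm // p'M /= pnatNK index_quotient_eq //.
- by rewrite subIset ?sNM ?orbT.
- exact: normal_sub.
exact: normal_norm.
Qed.

Lemma p_nilpotent_quotientI G N1 N2 :
  N1 <| G -> N2 <| G -> p_nilpotent p (G / N1) -> p_nilpotent p (G / N2) ->
  p_nilpotent p (G / (N1 :&: N2)).
Proof.
move=> nN1 nN2.
case/(p_nilpotent_quotientP nN1)=> M1 /andP[sNM1 nM1] /andP[p'1 p1].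
case/(p_nilpotent_quotientP nN2)=> M2 /andP[sNM2 nM2] /andP[p'2 p2].
have dvdI (A B C : {group gT}) : C <| A -> #|A :&: B : C| %| #|A : C|.
  case/andP=> sCA nCA; have sIA := subsetIl A B.
  by rewrite -!card_quotient ?(subset_trans sIA) // cardSg ?quotientS.
have sN1 : N1 :&: N2 \subset M1 :&: M2 by apply: setISS.
apply/(p_nilpotent_quotientP (normalI nN1 nN2)); exists (M1 :&: M2)%G.
  by rewrite sN1 normalI.
apply/andP; split.
  rewrite -(@Lagrange_index _ _ (M1 :&: N2)%G) ?setIS ?setSI // pnatM.
  apply/andP; split.
    have -> : (M1 :&: N2)%G :=: M2 :&: M1 :&: N2.
      by rewrite /= -setIA setICA (setIidPr sNM2).
    rewrite /= [M1 :&: M2]setIC indexgI; apply: pnat_dvd p'2; apply: dvdI.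
    exact: normalS sNM2 (normal_sub nM2) nN2.
  have -> : (N1 :&: N2)%G :=: M1 :&: N2 :&: N1 by rewrite /= setIAC (setIidPr sNM1).
  rewrite indexgI; apply: pnat_dvd p'1; apply: dvdI.
  exact: normalS sNM1 (normal_sub nM1) nN1.
rewrite -(@Lagrange_index _ G M1 (M1 :&: M2)%G) ?(normal_sub nM1) ?subsetIl //.
rewrite pnatM p1 /= indexgI; apply: pnat_dvd p2.
by rewrite -{1}(setIidPr (normal_sub nM1)); apply: dvdI.
Qed.

Lemma p_nilpotent_residual_group_set G : group_set (p_nilpotent_residual p G).
Proof. exact: group_set_bigcap. Qed.

Canonical p_nilpotent_residual_group G :=
  Group (p_nilpotent_residual_group_set G).

Lemma p_nilpotent_residualP G :
  p_nilpotent_residual p G <| G /\ p_nilpotent p (G / p_nilpotent_residual p G).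
Proof.
pose good N := (N <| G) && p_nilpotent p (G / N).
have goodG : good G.
  rewrite /good normal_refl trivg_quotient; apply/existsP; exists 1%G.
  by rewrite normal_refl pHallE sub1G cards1 partn1.
have: exists2 N : {group gT}, good N & N :=: G :&: p_nilpotent_residual p G.
  rewrite /p_nilpotent_residual.
  apply: (big_ind (fun A => exists2 N, good N & N :=: G :&: A)).
  - by exists G; rewrite ?setIT.
  - move=> A B [N1 /andP[nN1 pN1] defN1] [N2 /andP[nN2 pN2] defN2].
    exists (N1 :&: N2)%G; last by rewrite /= defN1 defN2 setIACA setIid.
    by rewrite /good normalI ?p_nilpotent_quotientI.
  by move=> N gN; exists N; rewrite ?(setIidPr _) ?normal_sub //; case/andP: gN.
have sRG : p_nilpotent_residual p G \subset G by apply: bigcap_inf goodG.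
by rewrite (setIidPr sRG) => -[N /andP[nN pN] <-].
Qed.

Lemma p_nilpotent_residual_min G N :
  N <| G -> p_nilpotent p (G / N) -> p_nilpotent_residual p G \subset N.
Proof. by move=> nNG pN; apply: bigcap_inf; rewrite nNG. Qed.

End Residual.

(* Main.v *)
Require Import Defs.
From mathcomp Require Import all_boot all_fingroup all_solvable ssralg finalg.

Set Implicit Arguments.
Unset Strict Implicit.
Unset Printing Implicit Defensive.

Local Open Scope group_scope.

(** If G is p-nilpotent, take H = 1: its only subgroup lies in the hypercenter.

For the converse, let G fail to be p-nilpotent. By Frobenius' criterion
(Frobenius_p_nilpotent) some element x of prime power order q^e, q <> p,
normalizes a p-subgroup of G without centralizing it. Let V be minimal among
the p-subgroups normalized but not centralized by x. Coprime action then gives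
V = [V, x] and C_V(x) = Phi(V) <= Z(V), so that V has class at most 2, and some
a = [b, y] outside Phi(V), with y in <x>, satisfies a^p = 1, or a^4 = 1 when
p = 2 and V is not abelian (minimal_action_element). Counting the orbits of <x>
shows that q divides |V : Phi(V)| - 1, so the hypothesis on |G| forces
|V : Phi(V)| > p^n.

As V = [V, x], V lies in the p-nilpotent residual, and x centralizes every
subgroup of V contained in the hypercenter. The heart of the proof is that a
subgroup L of V not contained in Phi(V) must be all of V as soon as it has a
p-nilpotent supplement or satisfies one of the two embedding conditions.
- If G = L T with T p-nilpotent, a conjugate of x under L lies in the normal
  p-complement of T and so centralizes the p-group V :&: T. Hence
  V = L (V :&: T) = L Phi(V) = L (p_nilpotent_supplement_eq).
- A subgroup S permuting with a Sylow q-subgroup Q that contains x satisfies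
  V :&: S Q = A whenever A <= V is a Sylow p-subgroup of S: so x normalizes A
  (permuting_Sylow_norm). This shows that x normalizes all the subgroups that
  generate L_seG and L_tauG and, when applied modulo K, that it normalizes L K.
  By minimality V <= L K, and then either V :&: K <= Phi(V) and
  V = L Phi(V) = L, or V <= K and L is one of these cores, hence is normalized
  but not centralized by x, whence L = V (triangle_eq).
Finally <a> either extends to a subgroup of V of order p^n < |V|, or is cyclic
of order 4 with p = 2, n = 1 and V not abelian; neither can be equal to V.

The conditions imposed on L are used in G itself, through the action of x, so
that they never have to be inherited by subgroups or quotients of G. *)

(** * Frobenius' criterion for p-nilpotency *)

Section Fusion.

Import GRing.Theory FinRing.Theory FiniteModule.

Variable gT : finGroupType.
Implicit Types G N Q S T U : {group gT}.

(** The transfer of G into S / S' kills G', while it maps g in S to the product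
of the conjugates of powers of g that its cycle decomposition produces. Fusion
being trivial modulo S', that product is g ^ |G : S|, and |G : S| is prime to
p. *)
Lemma Sylow_derI_trivial_fusion (p : nat) G S :
    p.-Sylow(G) S ->
    {in S & G, forall a g, a ^ g \in S -> [~ a, g] \in S^`(1)} ->
  S :&: G^`(1) = S^`(1).
Proof.
move=> sylS fusS; have [sSG pS iSG] := and3P sylS.
apply/eqP; rewrite eqEsubset subsetI der_sub dergS // !andbT.
apply/subsetP=> g /setIP[Sg G'g]; have Gg := subsetP sSG g Sg.
have nDS := der_norm 1 S.
pose alpha := restrm_morphism nDS (coset_morphism S^`(1)).
have im_alpha : alpha @* S = S / S^`(1) by rewrite morphim_restrm setIid.
have abS : abelian (alpha @* S) by rewrite im_alpha sub_der1_abelian.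
have trans_g : transfer G abS g = 0%R.
  have sG'ker : G^`(1) \subset 'ker (transfer G abS).
    rewrite gen_subG; apply/subsetP=> _ /imset2P[h1 h2 Gh1 Gh2 ->].
    apply/kerP; first exact: groupR.
    rewrite morphR // /commg /conjg /= !zmodMgE !zmodVgE.
    by rewrite [X in (_ + X)%R]addrC addrK addNr.
  by move/kerP: (subsetP sG'ker g G'g); apply.
have trX := transversalP (rcosets_cycle_partition sSG Gg).
set X := transversal _ _ in trX; have /and3P[_ sXG _] := trX.
have power0 : (fmod abS (alpha g) *+ #|G : S| = 0)%R.
  rewrite -trans_g (transfer_cycle_expansion sSG abS Gg trX).
  rewrite -(sum_index_rcosets_cycle sSG Gg trX) -sumrMnr /restrm.
  apply: eq_bigr => x Xx; rewrite -[(_ *+ _)%R]morphX ?mem_morphim //=.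
  rewrite -morphX //= /restrm; congr fmod.
  have Sgx : (g ^+ #|<[g]> : S :* x|) ^ x^-1 \in S.
    by rewrite conjgE invgK mulgA -mem_rcoset mulg_exp_card_rcosets.
  apply/rcoset_kercosetP; rewrite ?(subsetP nDS) ?groupX //.
  rewrite mem_rcoset -{1}[g ^+ _]invgK -conjVg -commgEl fusS //.
  - by rewrite groupV groupX.
  - by rewrite groupV (subsetP sXG).
  by rewrite conjVg groupV.
move/(congr_fmod): power0; rewrite fmval0 morphX ?inE //= fmodK ?mem_morphim //.
move/(congr1 (fun y => y ^+ expg_invn (S / S^`(1)) #|G : S|)).
rewrite /restrm /= expg1n expgK ?mem_quotient //.
  by move=> Kg1; rewrite coset_idr ?(subsetP nDS).
exact: pnat_coprime (quotient_pgroup _ pS) iSG.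
Qed.

Lemma cent_mul_Sylow_norm (p : nat) G U Q :
    p.-group ('N_G(U) / 'C_G(U)) -> p.-Sylow('N_G(U)) Q ->
  'C_G(U) * Q = 'N_G(U).
Proof.
move=> pNC sylQ; have nCN : 'C_G(U) <| 'N_G(U) by apply: subcent_normal.
have nCQ := subset_trans (pHall_sub sylQ) (normal_norm nCN).
have sylq := quotient_pHall nCQ sylQ.
have defq : Q / 'C_G(U) = 'N_G(U) / 'C_G(U).
  by rewrite (sub_pHall sylq pNC) ?quotientS ?(pHall_sub sylQ).
by rewrite -(quotientGK nCN) -defq quotientK.
Qed.

(** Sylow subgroups can be conjugated without moving their intersection D. When
D is proper it grows inside both normalizers, so S and T can be joined through
Sylow subgroups of G that contain Sylow subgroups of N_G(D); the latter are
conjugate under C_G(D), and the other two steps have intersections larger than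
D. *)
Lemma Sylow_trans_cent_setI (p : nat) G S T :
    (forall U, U \subset G -> p.-group U -> p.-group ('N_G(U) / 'C_G(U))) ->
    p.-Sylow(G) S -> p.-Sylow(G) T ->
  exists2 c, c \in 'C_G(S :&: T) & T :=: S :^ c.
Proof.
move=> NCp; have [m] := ubnP (#|S| - #|S :&: T|).
elim: m S T => // m IHm S T; rewrite ltnS => lem sylS sylT.
have [sSG pS _] := and3P sylS; have [sTG pT _] := and3P sylT.
have oST : #|T| = #|S| by rewrite (card_Hall sylS) (card_Hall sylT).
pose D := (S :&: T)%G; have [sDS sDT] : D \subset S /\ D \subset T.
  by rewrite subsetIl subsetIr.
have [eqDS | neqDS] := eqVneq (D : {set gT}) S.
  exists 1; rewrite ?group1 ?conjsg1 //; apply/eqP.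
  by rewrite eq_sym eqEcard oST leqnn -eqDS sDT.
have prDS : D \proper S by rewrite properEneq neqDS.
have prDT : D \proper T by rewrite properEcard sDT oST proper_card.
have nSD := nilpotent_proper_norm (pgroup_nil pS) prDS.
have nTD := nilpotent_proper_norm (pgroup_nil pT) prDT.
have sDG := subset_trans sDS sSG.
have sup (R : {group gT}) : R \subset G -> p.-group R ->
    {Q : {group gT} | p.-Sylow('N_G(D)) Q & 'N_R(D) \subset Q}.
  move=> sRG pR; apply: Sylow_superset; first exact: setSI.
  exact: pgroupS (subsetIl _ _) pR.
have [Q1 sylQ1 sSQ1] := sup S sSG pS.
have [Q2 sylQ2 sTQ2] := sup T sTG pT.
have [c2 Cc2 defQ2] : exists2 c, c \in 'C_G(D) & Q2 :=: Q1 :^ c.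
  have nCN : 'C_G(D) <| 'N_G(D) by apply: subcent_normal.
  have defN := cent_mul_Sylow_norm (NCp D sDG (pgroupS sDS pS)) sylQ1.
  have [x Nx ->] := Sylow_trans sylQ1 sylQ2.
  have /mulsgP[c y Cc Q1y ->] : x \in 'C_G(D) * Q1 by rewrite defN.
  have /normP defQy : y \in 'N(Q1) by rewrite (subsetP (normG _)).
  exists (c ^ y).
    rewrite memJ_norm // (subsetP (normal_norm nCN)) //.
    by rewrite (subsetP (pHall_sub sylQ1)).
  by rewrite conjsgM -{2}defQy -!conjsgM conjgE !mulgA mulgV mul1g.
have [S1 sylS1 sQ1S1] : {S1 : {group gT} | p.-Sylow(G) S1 & Q1 \subset S1}.
  apply: Sylow_superset (pHall_pgroup sylQ1).
  exact: subset_trans (pHall_sub sylQ1) (subsetIl _ _).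
have Gc2 : c2 \in G by case/setIP: Cc2.
have sylS2 : p.-Sylow(G) (S1 :^ c2)%G by rewrite pHallJ.
have step (A B R : {group gT}) : p.-Sylow(G) A -> p.-Sylow(G) B ->
    D \proper R -> R \subset A -> R \subset B ->
    exists2 c, c \in 'C_G(D) & B :=: A :^ c.
  move=> sylA sylB prDR sRA sRB.
  have prD : D \proper A :&: B.
    by rewrite (proper_sub_trans prDR) // subsetI sRA.
  have [|c Cc ->] := IHm A B _ sylA sylB.
    apply: leq_trans lem; rewrite (card_Hall sylA) -(card_Hall sylS).
    by rewrite ltn_sub2l ?proper_card.
  by exists c => //; rewrite (subsetP _ _ Cc) // setIS ?centS // proper_sub.
have [c1 Cc1 defS1] := step S S1 'N_S(D)%G sylS sylS1 nSD
  (subsetIl _ _) (subset_trans sSQ1 sQ1S1).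
have [|c3 Cc3 defT] :=
    step (S1 :^ c2)%G T 'N_T(D)%G sylS2 sylT nTD _ (subsetIl _ _).
  by rewrite (subset_trans sTQ2) // defQ2 conjSg.
exists (c1 * c2 * c3); first by rewrite !groupM.
by rewrite defT /= defS1 !conjsgM.
Qed.

Lemma p_nilpotent_pcore (p : nat) G : p_nilpotent p G = p^'.-Hall(G) 'O_p^'(G).
Proof.
apply/existsP/idP=> [[N /andP[nNG hallN]] | hallO].
  by rewrite (normal_Hall_pcore hallN).
by exists 'O_p^'(G)%G; rewrite pcore_normal.
Qed.

Lemma p_nilpotent_normal (p : nat) G N :
  N <| G -> p.-nat #|G : N| -> p_nilpotent p N -> p_nilpotent p G.
Proof.
move=> nNG pGN; rewrite p_nilpotent_pcore => hallO.
apply/existsP; exists 'O_p^'(N)%G.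
rewrite (char_normal_trans (pcore_char _ _) nNG) pHallE.
rewrite (subset_trans (pcore_sub _ _)) ?normal_sub //= (card_Hall hallO).
rewrite -(Lagrange (normal_sub nNG)) partnM //.
by rewrite (@part_p'nat _ #|G : N|) ?pnatNK // muln1.
Qed.

(** By Sylow_trans_cent_setI and the hypothesis for S itself, fusion in a Sylow
p-subgroup S is induced by S, so S :&: G' = S' < S. Thus p divides |G / G'|, and
G has a proper normal subgroup of p-power index, to which induction applies. *)
Theorem Frobenius_p_nilpotent (p : nat) G :
    prime p ->
    (forall U, U \subset G -> p.-group U -> p.-group ('N_G(U) / 'C_G(U))) ->
  p_nilpotent p G.
Proof.
move=> p_pr; have [m] := ubnP #|G|.
elim: m G => // m IHm G; rewrite ltnS => lem NCp.
have [S sylS] := Sylow_exists p G; have [sSG pS _] := and3P sylS.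
have [S1 | ntS] := eqVneq (S : {set gT}) 1.
  apply/existsP; exists G; rewrite normal_refl pHallE subxx /=.
  by rewrite -{1}(partnC p (cardG_gt0 G)) -(card_Hall sylS) S1 cards1 mul1n.
have defS' : S :&: G^`(1) = S^`(1).
  apply: (Sylow_derI_trivial_fusion sylS) => a g Sa Gg Sag.
  have sylSg : p.-Sylow(G) (S :^ g)%G by rewrite pHallJ.
  have [c /setIP[Gc Cc] defS] := Sylow_trans_cent_setI NCp sylSg sylS.
  have Cag : (a ^ g) ^ c = a ^ g.
    by rewrite /conjg -(centP Cc) ?mulKg // inE memJ_conjg Sa.
  have Ngc : g * c \in 'N_G(S).
    by rewrite inE groupM //=; apply/normP; rewrite conjsgM -defS.
  have defN : 'C_G(S) * S = 'N_G(S).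
    by apply: cent_mul_Sylow_norm (NCp S sSG pS) _; rewrite Sylow_subnorm.
  have /mulsgP[z y /setIP[_ Cz] Sy defgc] : g * c \in 'C_G(S) * S.
    by rewrite defN.
  have -> : [~ a, g] = [~ a, y].
    rewrite !commgEl; congr (_ * _); rewrite -Cag -conjgM defgc conjgM.
    by congr (_ ^ _); rewrite /conjg -(centP Cz) ?mulKg.
  by rewrite mem_commg.
have solS := pgroup_sol pS.
have prS' : S^`(1) \proper S by rewrite (sol_der1_proper solS) ?subxx.
pose Q := 'O_p^'(G / G^`(1))%G.
have nQG : Q <| G / G^`(1) by apply: pcore_normal.
have [N defQ sG'N nNG] := inv_quotientN (der_normal 1 G) nQG.
have hallQ : p^'.-Hall(G / G^`(1)) Q.
  by apply: nilpotent_pcore_Hall; apply: abelian_nil; apply: der_abelian.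
have iGN : #|G : N| = #|G / G^`(1) : N / G^`(1)|.
  by rewrite index_quotient_eq ?der_norm ?(normal_sub nNG) ?subIset ?sG'N ?orbT.
have pGN : p.-nat #|G : N|.
  by rewrite iGN -defQ -pnatNK; case/and3P: hallQ.
have prNG : N \proper G.
  rewrite properEneq normal_sub // andbT; apply: contraTneq prS' => eqNG.
  have defGq : Q :=: G / G^`(1) by rewrite defQ eqNG.
  have p'Gq : p^'.-group (G / G^`(1)) by rewrite -defGq; apply: pcore_pgroup.
  have sSG' : S \subset G^`(1).
    rewrite -quotient_sub1 ?(subset_trans sSG) ?der_norm //.
    rewrite -(coprime_TIg (pnat_coprime (quotient_pgroup _ pS) p'Gq)).
    by rewrite subsetI subxx quotientS.
  by rewrite -defS' (setIidPl sSG') properxx.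
apply: (p_nilpotent_normal nNG pGN); apply: IHm.
  exact: leq_trans (proper_card prNG) lem.
move=> U sUN pU; have sNG := proper_sub prNG.
have nCN (M : {group gT}) : 'N_M(U) \subset 'N('C_M(U)).
  exact: normal_norm (subcent_normal _ _).
have pGU := NCp U (subset_trans sUN sNG) pU.
have defC : 'N_N(U) :&: 'C_G(U) = 'C_N(U).
  by rewrite setIACA (setIidPl sNG) (setIidPr (cent_sub _)).
have iNC : #|'N_N(U) : 'C_N(U)| = #|'N_N(U) : 'C_G(U)| by rewrite -defC indexgI.
rewrite /pgroup card_quotient // iNC.
rewrite -card_quotient ?(subset_trans (setSI _ sNG) (nCN G)) //.
by apply: pgroupS pGU; rewrite quotientS ?setSI.
Qed.

End Fusion.

Lemma not_p_nilpotent_p'elt_action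
    (gT : finGroupType) (p : nat) (G : {group gT}) :
    prime p -> ~~ p_nilpotent p G ->
  exists q (U : {group gT}) x,
    [/\ prime q, q != p, q.-elt x, x \in G &
      [/\ U \subset G, p.-group U, x \in 'N(U) & x \notin 'C(U)]].
Proof.
move=> p_pr npG; have /existsP[U] :
    [exists U : {group gT},
       [&& U \subset G, p.-group U & ~~ p.-group ('N_G(U) / 'C_G(U))]].
  apply: contraR npG => /existsPn noU.
  apply: Frobenius_p_nilpotent => // U sUG pU.
  by move: (noU U); rewrite sUG pU /= negbK.
case/and3P=> sUG pU; have nCN : 'C_G(U) <| 'N_G(U) by apply: subcent_normal.
rewrite /pgroup card_quotient ?normal_norm // => notp.
move: notp; rewrite /pnat indexg_gt0 => /allPn[q].
rewrite mem_primes => /and3P[pr_q _ q_dv] q'p.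
have [Q sylQ] := Sylow_exists q 'N_G(U).
have /subsetPn[x Qx nCx] : ~~ (Q \subset 'C_G(U)).
  apply: contraL q_dv => sQC.
  rewrite -p'natE //; apply: pnat_dvd (indexgS _ sQC) _.
  by case/and3P: sylQ.
have /setIP[Gx Nx] := subsetP (pHall_sub sylQ) x Qx.
exists q, U, x; split=> //; first exact: mem_p_elt (pHall_pgroup sylQ) Qx.
by split=> //; apply: contra nCx => Cx; rewrite inE Gx.
Qed.

(** * Minimal nontrivial coprime action on a p-group *)

Lemma minimal_action_exists (gT : finGroupType) (U : {group gT}) x :
    x \in 'N(U) -> x \notin 'C(U) ->
  exists V : {group gT}, [/\ V \subset U, x \in 'N(V), x \notin 'C(V) &
    forall W : {group gT}, W \proper V -> x \in 'N(W) -> x \in 'C(W)].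
Proof.
move=> nUx ncUx; pose acted (W : {group gT}) :=
  [&& W \subset U, x \in 'N(W) & x \notin 'C(W)].
have actedU : acted U by rewrite /acted subxx nUx.
case: (arg_minnP (fun W : {group gT} => #|W|) actedU).
move=> V /and3P[sVU nVx ncVx] minV; exists V; split=> // W prWV nWx.
apply: contraTT (proper_card prWV) => ncWx; rewrite -leqNgt minV //.
by rewrite /acted nWx ncWx (subset_trans (proper_sub prWV)).
Qed.

Section MinimalAction.

Variables (gT : finGroupType) (p : nat) (V : {group gT}) (x : gT).
Hypotheses (p_pr : prime p) (pV : p.-group V) (p'x : p^'.-elt x).
Hypotheses (nVx : x \in 'N(V)) (ncVx : x \notin 'C(V)).
Hypothesis minV :
  forall U : {group gT}, U \proper V -> x \in 'N(U) -> x \in 'C(U).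

Let coVx : coprime #|V| #|<[x]>| := pnat_coprime pV p'x.
Let nVX : <[x]> \subset 'N(V). Proof. by rewrite cycle_subG. Qed.

(** Otherwise x centralizes [V, x], so each commutator [a, x] is both a p-element
and, being up to inversion the quotient of the commuting p'-elements x ^ a and
x, a p'-element. *)
Lemma minimal_action_comm : [~: V, <[x]>] = V.
Proof.
apply: contraNeq ncVx => neqV.
have sVV : [~: V, <[x]>] \subset V by rewrite commg_subl.
have cx : x \in 'C([~: V, <[x]>]).
  apply: minV; first by rewrite properEneq neqV.
  by rewrite (subsetP (commg_normr _ _)) ?cycle_id.
apply/centP=> a Va; apply/esym/commgP; apply/eqP.
have Wc : [~ a, x] \in [~: V, <[x]>] by rewrite mem_commg ?cycle_id.
have cxc : commute x [~ a, x] by apply: (centP cx).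
have p_c : p.-elt [~ a, x] by rewrite (mem_p_elt pV) ?(subsetP sVV).
have xa : x ^ a = x * [~ a, x]^-1 by rewrite invg_comm commgEl mulKVg.
have c_x : [~ a, x]^-1 ^+ #[x] = 1.
  have: (x ^ a) ^+ #[x] = 1 by rewrite -conjXg expg_order conj1g.
  by rewrite xa expgMn ?expg_order ?mul1g //; apply: commuteV.
apply/eqP; rewrite -order_eq1 -dvdn1.
rewrite -(eqP (pnat_coprime p_c p'x)) dvdn_gcd dvdnn /= order_dvdn.
by rewrite -eq_invg1 -expgVn c_x.
Qed.

(** Minimality gives one inclusion. For the other, fixed points lift from the
abelian group V / Phi(V), where there are none since V = [V, x]. *)
Lemma minimal_action_cent_Phi : 'C_V[x] = 'Phi(V).
Proof.
have solV := pgroup_sol pV; have ntV : V :!=: 1.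
  by apply: contraNneq ncVx => ->; rewrite cent1T inE.
have nPx : <[x]> \subset 'N('Phi(V)) by apply: char_norm_trans (Phi_char V) nVX.
apply/eqP; rewrite eqEsubset subsetI Phi_sub /= -cent_cycle andbC.
rewrite centsC cycle_subG minV ?Phi_proper //=; last by rewrite -cycle_subG.
rewrite -quotient_sub1 ?(subset_trans (subsetIl _ _)) ?gFnorm //.
rewrite coprime_quotient_cent ?Phi_sub //.
have defVq : [~: V / 'Phi(V), <[x]> / 'Phi(V)] = V / 'Phi(V).
  by rewrite -quotientR ?gFnorm // minimal_action_comm.
have := @coprime_abel_cent_TI _ (<[x]> / 'Phi(V)) (V / 'Phi(V)).
rewrite /= defVq => -> //; first exact: quotient_norms.
  exact: coprime_morph.
exact: abelem_abelian (Phi_quotient_abelem pV).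
Qed.

(** The three subgroups lemma for V, <x> and Phi(V): as x centralizes Phi(V), two
of the triple commutators are trivial, hence so is [[x, V], Phi(V)]. *)
Lemma minimal_action_Phi_center : 'Phi(V) \subset 'Z(V).
Proof.
rewrite subsetI Phi_sub centsC; apply/commG1P.
have cPx : [~: 'Phi(V), <[x]>] = 1.
  by apply/commG1P; rewrite -minimal_action_cent_Phi cent_cycle subsetIr.
apply/eqP; rewrite -subG1 -{1}minimal_action_comm (commGC V <[x]>).
rewrite /=; have -> : [~: <[x]>, V, 'Phi(V)] = 1; last by [].
apply: three_subgroup.
  apply/eqP; rewrite -subG1 -cPx commSg // commg_subr gFnorm //.
by rewrite cPx comm1G.
Qed.

(** Take a = [b, y] = b^-1 b^y with y in <x>. In class 2, a^k is the product of
b^-k, (b^y)^k and z^C(k,2) for a central commutator z with z^p = 1. When p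
divides k, y fixes b^k because b^p is in Phi(V), so that only z^C(k,2) is left.
This is trivial for k = p odd, for k = 4 with p = 2, and when V is abelian. *)
Lemma minimal_action_element :
  exists2 a, a \in V :\: 'Phi(V) &
    a ^+ p = 1 \/ [/\ p = 2%N, ~~ abelian V & a ^+ 4 = 1].
Proof.
have ntV : V :!=: 1.
  by apply: contraNneq ncVx => ->; rewrite cent1T inE.
have /subsetPn[_ /imset2P[b y Vb Xy ->] nPby] :
    ~~ (commg_set V <[x]> \subset 'Phi(V)).
  rewrite -gen_subG -/(commutator _ _) minimal_action_comm.
  by rewrite proper_subn ?Phi_proper.
have Nyx := subsetP nVX y Xy.
have Vby : b ^ y \in V by rewrite memJ_norm.
have Va : [~ b, y] \in V by rewrite commgEl groupM ?groupV.
exists [~ b, y]; first by rewrite inE nPby.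
have sPZ := minimal_action_Phi_center.
have PhiX g : g \in V -> g ^+ p \in 'Phi(V).
  move=> Vg; rewrite (Phi_joing pV) mem_gen // inE orbC.
  by rewrite (Mho_p_elt 1) ?(mem_p_elt pV).
have PhiR g h : g \in V -> h \in V -> [~ g, h] \in 'Phi(V).
  by move=> Vg Vh; rewrite (Phi_joing pV) mem_gen // inE mem_commg.
have cPV g h : g \in 'Phi(V) -> h \in V -> commute g h.
  by move=> /(subsetP sPZ)/setIP[_ /centP cVg] /cVg.
pose z := [~ b ^ y, b^-1].
have Pz : z \in 'Phi(V) by rewrite PhiR ?groupV.
have zp : z ^+ p = 1.
  rewrite /z -commXg; last first.
    by apply: commute_sym; apply: cPV; rewrite ?PhiR ?groupV.
  by apply/eqP/commgP; apply: cPV; rewrite ?PhiX ?groupV.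
have powE k : p %| k -> [~ b, y] ^+ k = z ^+ 'C(k, 2).
  case/dvdnP=> m ->; rewrite commgEl expMg_Rmul; last 2 first.
  - by apply: commute_sym; apply: cPV.
  - by apply: commute_sym; apply: cPV; rewrite ?groupV.
  have cby : (b ^ y) ^+ (m * p) = b ^+ (m * p).
    rewrite -conjXg mulnC expgM; apply/conjg_fixP/commgP.
    have: b ^+ p ^+ m \in 'C_V[x].
      by rewrite minimal_action_cent_Phi groupX ?PhiX.
    by case/setIP=> _; rewrite -cent_cycle => /centP/(_ y Xy).
  by rewrite cby expVgn mulVg mul1g.
have [p2 | odd_p] := even_prime p_pr; last first.
  left; rewrite powE // -(expg_mod _ zp).
  by have /eqP-> : p %| 'C(p, 2) by rewrite bin2odd ?dvdn_mulr.
have [abV | nabV] := boolP (abelian V); [left | right].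
  rewrite powE //; have -> : z = 1; last by rewrite expg1n.
  by apply/eqP/commgP; apply: (centsP abV); rewrite ?groupV.
split=> //; rewrite powE ?p2 //; rewrite -(expg_mod _ zp) p2 //.
Qed.

End MinimalAction.

(** * Orbit counting and orders of p-subgroups *)

Section Counting.

Variable gT : finGroupType.

(** |W| and |C_W(x)| are congruent modulo q, and both are prime to q. *)
Lemma dvdn_index_cent1 (q : nat) (W : {group gT}) x :
    q.-elt x -> coprime q #|W| -> x \in 'N(W) ->
  q %| #|W : 'C_W[x]| - 1.
Proof.
move=> qx co_qW nWx.
have := @pgroup_fix_mod _ _ _ 'J q <[x]>%G W qx.
rewrite afixJ cent_cycle astabsJ cycle_subG => /(_ nWx)/eqP.
rewrite -{1}(Lagrange (subsetIl W 'C[x])) eqn_mod_dvd ?leq_pmulr //.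
rewrite -{2}[#|_|]muln1 -mulnBr Gauss_dvdr //.
exact: coprime_dvdr (cardSg (subsetIl _ _)) co_qW.
Qed.

(** The index p^m of C_W(x) has m > 0, and q divides p^m - 1, so that m > n. *)
Lemma pgroup_index_cent1_gt (p q n : nat) (W : {group gT}) x :
    prime p -> prime q -> q != p ->
    (forall i, 0 < i <= n -> coprime q (p ^ i - 1)) ->
    p.-group W -> q.-elt x -> x \in 'N(W) -> x \notin 'C(W) ->
  p ^ n < #|W : 'C_W[x]|.
Proof.
move=> p_pr q_pr neq_qp co_q pW qx nWx ncWx.
have co_qW : coprime q #|W|.
  rewrite prime_coprime // -p'natE //.
  by apply: sub_in_pnat pW => r _ /eqnP->; rewrite !inE eq_sym.
have q_dv := dvdn_index_cent1 qx co_qW nWx.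
have /p_natP[m def_i] : p.-nat #|W : 'C_W[x]|.
  exact: pnat_dvd (dvdn_indexg _ _) pW.
rewrite def_i ltn_exp2l ?prime_gt1 // ltnNge; apply/negP=> le_mn.
have m_gt0 : 0 < m.
  rewrite lt0n; apply: contra ncWx => /eqP m0; move: def_i; rewrite m0 => /eqP.
  rewrite indexg_eq1 subsetI subxx /= => sWC.
  by rewrite -sub_cent1.
have := co_q m; rewrite m_gt0 le_mn -def_i => /(_ isT).
by rewrite prime_coprime // q_dv.
Qed.

Lemma pgroup_intermediate (p n : nat) (U V : {group gT}) :
    p.-group V -> U \subset V -> #|U| <= p ^ n <= #|V| ->
  exists2 L : {group gT}, U \subset L & L \subset V /\ #|L| = (p ^ n)%N.
Proof.
have [m] := ubnP #|V|; elim: m V => // m IHm V.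
rewrite ltnS => lem pV sUV /andP[leUn lenV].
have [eqV | neqV] := eqVneq #|V| (p ^ n)%N; first by exists V.
have ltnV : p ^ n < #|V| by rewrite ltn_neqAle eq_sym neqV.
have prUV : U \proper V by rewrite properEcard sUV (leq_ltn_trans leUn).
have [/= eqUV | [M maxM sUM]] := maximal_exists sUV.
  by rewrite eqUV properxx in prUV.
have sMV := proper_sub (maxgroupp maxM).
have iM := p_maximal_index pV maxM.
have ntV : V :!=: 1.
  by apply: contraTneq prUV => ->; rewrite properE sub1G andbF.
have [p_pr _ _] := pgroup_pdiv pV ntV.
have [k oM] := p_natP (pgroupS sMV pV).
have leM : p ^ n <= #|M|.
  move: ltnV; rewrite -(Lagrange sMV) iM oM -expnSr.
  by rewrite ltn_exp2l ?leq_exp2l ?prime_gt1 // ltnS.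
have [||L sUL [sLM oL]] := IHm M _ (pgroupS sMV pV) sUM.
- exact: leq_trans (proper_card (maxgroupp maxM)) lem.
- by rewrite leUn.
by exists L => //; split=> //; apply: subset_trans sMV.
Qed.

End Counting.

(** * Subgroups permuting with a Sylow q-subgroup *)
(** As Q is a p'-group, A is still a Sylow p-subgroup of the group S Q, so that
A = V :&: S Q, and x normalizes both factors. *)
Lemma permuting_Sylow_norm
    (gT : finGroupType) (p : nat) (S A Q V : {group gT}) x :
    p.-Sylow(S) A -> permutes S Q -> p^'.-group Q ->
    p.-group V -> A \subset V -> x \in Q -> x \in 'N(V) ->
  x \in 'N(A).
Proof.
move=> sylA /eqP cSQ p'Q pV sAV Qx nVx; have [sAS pA _] := and3P sylA.
have defSQ : S <*> Q = S * Q by apply: comm_joingE.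
have sylASQ : p.-Sylow(S <*> Q) A.
  rewrite pHallE (subset_trans sAS) ?joing_subl //= (card_Hall sylA).
  have p'I : p^'.-nat #|S :&: Q| by apply: pgroupS p'Q; apply: subsetIr.
  have /(congr1 (fun m => m`_p)%N) := mul_cardG S Q.
  rewrite -defSQ !partnM ?cardG_gt0 //.
  by rewrite (part_p'nat p'I) (part_p'nat p'Q) !muln1 => ->.
have defA : V :&: (S <*> Q) = A.
  apply: (sub_pHall sylASQ); rewrite ?subsetIr //.
    exact: pgroupS (subsetIl _ _) pV.
  by rewrite subsetI sAV (subset_trans sAS) ?joing_subl.
rewrite -cycle_subG -defA normsI ?cycle_subG //.
by rewrite (subsetP (normG _)) // mem_gen // inE Qx orbT.
Qed.

Section Permuting.

Variables (gT : finGroupType) (p q : nat) (G V Q : {group gT}) (x : gT).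
Implicit Types A K L : {group gT}.
Hypotheses (p_pr : prime p) (q_pr : prime q) (neq_qp : q != p).
Hypotheses (sylQ : q.-Sylow(G) Q) (Qx : x \in Q).
Hypotheses (sVG : V \subset G) (pV : p.-group V) (nVx : x \in 'N(V)).

Let p'Q : p^'.-group Q.
Proof.
by apply: sub_in_pnat (pHall_pgroup sylQ) => r _ /eqnP->; rewrite !inE.
Qed.

Let Gx : x \in G := subsetP (pHall_sub sylQ) x Qx.

Lemma S_quasinormal_permutes (L : {set gT}) : S_quasinormal L G -> permutes L Q.
Proof. by case/andP=> _ /forall_inP; apply; apply/SylowP; exists q. Qed.

Lemma S_quasinormally_embedded_norm A :
  A \subset V -> S_quasinormally_embedded A G -> x \in 'N(A).
Proof.
move=> sAV /andP[_ /forall_inP embA]; have pA := pgroupS sAV pV.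
have [-> | ntA] := eqVneq (A : {set gT}) 1; first by rewrite norm1 inE.
have /existsP[S /andP[qnS /SylowP[r r_pr sylA]]] :
    [exists M : {group gT}, S_quasinormal M G && Sylow M A].
  by apply: embA; apply/SylowP; exists p; rewrite // /pHall subxx indexgg pA.
have [_ p_dv _] := pgroup_pdiv pA ntA.
have eq_pr : p = r by apply/eqP; apply: (pgroupP (pHall_pgroup sylA)) p_dv.
rewrite -eq_pr in sylA.
exact: permuting_Sylow_norm sylA (S_quasinormal_permutes qnS) p'Q pV sAV Qx nVx.
Qed.

(** The condition V = [V, x] puts V inside the normal closure of Q, so that p
divides its order and A must permute with Q. *)
Lemma tau_quasinormal_norm A :
    V \subset [~: V, <[x]>] -> A \subset V -> tau_quasinormal A G ->
  x \in 'N(A).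
Proof.
move=> sVx sAV /tau_quasinormalP[_ qnA]; have pA := pgroupS sAV pV.
have [-> | ntA] := eqVneq (A : {set gT}) 1; first by rewrite norm1 inE.
have sVQ : V \subset normal_closure Q G.
  have sXN : <[x]> \subset normal_closure Q G.
    by rewrite cycle_subG mem_gen // (subsetP (sub_class_support _ _)).
  apply: subset_trans sVx (subset_trans (commgS _ sXN) _).
  by rewrite commg_subr (subset_trans sVG) // norms_gen ?class_support_norm.
have permAQ : permutes A Q.
  apply: qnA sylQ _ _ => //.
    apply: (@pnat_coprime q); first exact: pnat_id.
    by apply: pi_pnat pA _; rewrite !inE eq_sym.
  apply: contra ntA => co; rewrite trivg_card1 -dvdn1 -(eqP co) dvdn_gcd dvdnn.
  by rewrite cardSg // (subset_trans sAV).
apply: permuting_Sylow_norm permAQ p'Q pV sAV Qx nVx.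
by rewrite /pHall subxx indexgg pA.
Qed.

(** Modulo K the set L K becomes the p-group L K / K, which is its own Sylow
p-subgroup and permutes with Q K / K. *)
Lemma S_quasinormal_mulg_norm L K :
    L \subset V -> K <| G -> S_quasinormal (L * K) G -> x \in 'N(L <*> K).
Proof.
move=> sLV nKG qnLK; have nKx := subsetP (normal_norm nKG) x Gx.
have nK (B : {set gT}) : B \subset G -> B \subset 'N(K).
  by move=> sBG; apply: subset_trans sBG (normal_norm nKG).
have sLG := subset_trans sLV sVG; have sQG := pHall_sub sylQ.
have permq : permutes (L / K) (Q / K).
  have /eqP cLKQ := S_quasinormal_permutes qnLK.
  apply/eqP; rewrite -(quotientMidr K L) -!quotientMl ?cLKQ ?nK //.
  by rewrite mul_subG ?(normal_sub nKG).
have nLKx : coset K x \in 'N(L / K).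
  have [p'Qq pVq] := (quotient_pgroup K p'Q, quotient_pgroup K pV).
  apply: (permuting_Sylow_norm _ permq p'Qq pVq).
  - rewrite /pHall subxx indexgg -/(pgroup _ _).
    by rewrite quotient_pgroup ?(pgroupS sLV).
  - exact: quotientS.
  - exact: mem_quotient.
  by rewrite -cycle_subG -quotient_cycle // quotient_norms ?cycle_subG.
rewrite -cycle_subG (norm_joinEl (nK L sLG)) (normC (nK L sLG)).
rewrite -quotientK ?nK //.
by rewrite norm_quotient_pre ?quotient_cycle ?cycle_subG.
Qed.
End Permuting.

(** * Which subgroups of V can be embedded *)

Section Obstruction.

Variables (gT : finGroupType) (p q : nat) (G V Q : {group gT}) (x : gT).
Hypotheses (p_pr : prime p) (q_pr : prime q) (neq_qp : q != p).
Hypotheses (sylQ : q.-Sylow(G) Q) (Qx : x \in Q).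
Hypotheses (sVG : V \subset G) (pV : p.-group V).
Hypotheses (nVx : x \in 'N(V)) (ncVx : x \notin 'C(V)).
Hypothesis minV :
  forall U : {group gT}, U \proper V -> x \in 'N(U) -> x \in 'C(U).

Let qx : q.-elt x := mem_p_elt (pHall_pgroup sylQ) Qx.
Let p'x : p^'.-elt x.
Proof. by apply: sub_in_pnat qx => r _ /eqnP->; rewrite !inE. Qed.
Let Gx : x \in G := subsetP (pHall_sub sylQ) x Qx.
Let VxV : [~: V, <[x]>] = V := minimal_action_comm pV p'x nVx ncVx minV.
Let CVx : 'C_V[x] = 'Phi(V) := minimal_action_cent_Phi pV p'x nVx ncVx minV.

(** Modulo the residual R, x lies in the normal p-complement, which therefore
also contains the p-group V R / R = [V R / R, x]. *)
Lemma minimal_action_sub_residual : V \subset p_nilpotent_residual p G.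
Proof.
have [nRG] := p_nilpotent_residualP p G; rewrite p_nilpotent_pcore => hallO.
set R := p_nilpotent_residual p G in nRG hallO *.
have nRV := subset_trans sVG (normal_norm nRG).
have nRx : <[x]> \subset 'N(R).
  by rewrite cycle_subG (subsetP (normal_norm nRG)).
have coVO := pnat_coprime (quotient_pgroup R pV) (pcore_pgroup p^' (G / R)).
rewrite -quotient_sub1 // -(coprime_TIg coVO).
rewrite subsetI subxx -{1}VxV quotientR //.
have sXO : <[x]> / R \subset 'O_p^'(G / R).
  rewrite (sub_normal_Hall hallO) ?pcore_normal ?quotient_pgroup //.
  by rewrite quotientS ?cycle_subG.
apply: subset_trans (commgS _ sXO) _; rewrite commg_subr.
by rewrite (subset_trans (quotientS _ sVG)) // normal_norm ?pcore_normal.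
Qed.

(** By minimality it is enough to exclude that V lies in the hypercenter, and in
that case V = [V, x] would descend along the whole upper central series. *)
Lemma sub_hypercenter_cent (L : {group gT}) :
  L \subset V -> L \subset hypercenter G -> x \in 'C(L).
Proof.
move=> sLV sLZ.
have [prU | eqU] : V :&: hypercenter G \proper V \/ V \subset hypercenter G.
- rewrite properE subsetIl /= subsetI subxx /=.
  by case: (V \subset hypercenter G); [right | left].
- suffices: x \in 'C(V :&: hypercenter G).
    by apply/subsetP/centS; rewrite subsetI sLV.
  apply: minV prU _; rewrite -cycle_subG normsI ?cycle_subG //.
  by rewrite (subsetP (ucn_norm _ _)).
case/idPn: ncVx; suffices -> : V :=: 1 by rewrite cent1T inE.
apply/eqP; rewrite -subG1; move: eqU; rewrite /hypercenter.
elim: #|G| => [|k IHk] sVZ.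
  by rewrite -(ucn0 G).
apply: IHk; rewrite -VxV; apply: subset_trans (commgSS sVZ _) (ucn_comm k G).
by rewrite cycle_subG.
Qed.

Lemma sub_Phi_mul_eq (L : {group gT}) :
  L \subset V -> V \subset L * 'Phi(V) -> L :=: V.
Proof.
move=> sLV sVLP; have nPL : L \subset 'N('Phi(V)).
  by apply: subset_trans sLV (gFnorm _ _).
rewrite -[LHS]genGid; apply: Phi_nongen; apply/eqP.
by rewrite eqEsubset join_subG Phi_sub sLV norm_joinEr // -(normC nPL).
Qed.

(** A Sylow q-subgroup of T is one of G since |G : T| is a power of p, so T
contains a conjugate x ^ l, which may be taken with l in L as G = L T. *)
Lemma p_nilpotent_supplement_eq (L : {group gT}) :
  L \subset V -> has_p_nilpotent_supplement p L G -> L :=: V.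
Proof.
move=> sLV /existsP[T /and3P[sTG /eqP defG]].
rewrite p_nilpotent_pcore => hallO.
have pL := pgroupS sLV pV.
have pGT : p.-nat #|G : T|.
  have iGT : #|G : T| = #|L : T|.
    apply/eqP; rewrite -(eqn_pmul2r (cardG_gt0 T)) (LagrangeMr L T) defG.
    by rewrite mulnC Lagrange.
  by rewrite iGT; apply: pnat_dvd (dvdn_indexg _ _) pL.
have [S sylS] := Sylow_exists q T.
have sylSG : q.-Sylow(G) S.
  rewrite pHallE (subset_trans (pHall_sub sylS)) //= (card_Hall sylS).
  rewrite -(Lagrange sTG) partnM // (@part_p'nat _ #|G : T|) ?muln1 //.
  by apply: sub_in_pnat pGT => r _ /eqnP->; rewrite !inE eq_sym.
have sXG : <[x]> \subset G by rewrite cycle_subG.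
have [y Gy sxS] := Sylow_Jsub sylSG sXG qx.
have {Gy} : y \in L * T by rewrite defG.
case/mulsgP=> l t Ll Tt defy; have Vl := subsetP sLV l Ll.
have Txl : x ^ l \in T.
  rewrite -(memJ_conjg _ t) conjGid // -conjgM -defy.
  by rewrite (subsetP (pHall_sub sylS)) // (subsetP sxS) // memJ_conjg cycle_id.
have OTxl : x ^ l \in 'O_p^'(T).
  rewrite -cycle_subG (sub_normal_Hall hallO) ?pcore_normal ?cycle_subG //.
  by rewrite /pgroup -orderE orderJ.
have nVxl : x ^ l \in 'N(V).
  by rewrite groupJ // (subsetP (normG V)).
have cVT : V :&: T \subset 'C[x ^ l].
  rewrite -cent_cycle; apply/commG1P/trivgP.
  rewrite -(coprime_TIg (pnat_coprime pV (pcore_pgroup p^' T))) subsetI.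
  apply/andP; split.
    apply: subset_trans (commSg _ (subsetIl V T)) _.
    by rewrite commg_subl cycle_subG.
  apply: subset_trans (commgS _ (_ : _ \subset 'O_p^'(T))) _.
    by rewrite cycle_subG.
  rewrite commg_subr (subset_trans (subsetIr V T)) //.
  by rewrite normal_norm ?pcore_normal.
have sVT_Phi : V :&: T \subset 'Phi(V).
  have -> : 'Phi(V) = 'C_V[x] :^ l.
    by rewrite CVx (normP _) // (subsetP (gFnorm _ _)).
  rewrite conjIg conjGid // -cent1J subsetI subsetIl; exact: cVT.
apply: sub_Phi_mul_eq => //.
have {1}-> : V :=: L * (V :&: T).
  by rewrite setIC group_modl // defG (setIidPr sVG).
exact: mulgS.
Qed.

(** Both embedding conditions reduce to a normal K with L K S-quasinormal in G
such that x normalizes L as soon as L <= K. *)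
Lemma triangle_eq (L : {group gT}) :
  L \subset V -> x \notin 'C(L) -> triangle L G -> L :=: V.
Proof.
move=> sLV ncLx triL.
have eqLV : x \in 'N(L) -> L :=: V.
  move=> nLx; apply: contraNeq ncLx => neqLV; apply: minV => //.
  by rewrite properEneq neqLV.
suffices : exists2 K : {group gT}, K <| G &
    S_quasinormal (L * K) G /\ (L \subset K -> x \in 'N(L)).
  case=> K nKG [qnLK normL].
  have nKL : L \subset 'N(K).
    exact: subset_trans sLV (subset_trans sVG (normal_norm nKG)).
  have nKx : x \in 'N(K) by rewrite (subsetP (normal_norm nKG)).
  have nLKx :=
    S_quasinormal_mulg_norm q_pr neq_qp sylQ Qx sVG pV nVx sLV nKG qnLK.
  have sVLK : V \subset L <*> K.
    apply: contraNT ncLx => nsVLK.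
    suffices: x \in 'C(V :&: (L <*> K)).
      by apply/subsetP/centS; rewrite subsetI sLV joing_subl.
    apply: minV; first by rewrite properE subsetIl subsetI subxx.
    by rewrite -cycle_subG normsI ?cycle_subG.
  have [sVK | nsVK] := boolP (V \subset K).
    exact/eqLV/normL/(subset_trans sLV).
  have sVK_Phi : V :&: K \subset 'Phi(V).
    rewrite -CVx subsetI subsetIl sub_cent1; apply: minV.
      by rewrite properE subsetIl subsetI subxx.
    by rewrite -cycle_subG normsI ?cycle_subG.
  apply: sub_Phi_mul_eq => //.
  have {1}-> : V :=: L * (V :&: K).
    by rewrite setIC group_modl // -(norm_joinEl nKL) (setIidPr sVLK).
  exact: mulgS.
have norm_gen (P : pred {group gT}) :
    (forall A : {group gT}, A \subset V -> P A -> x \in 'N(A)) ->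
    L \subset <<\bigcup_(A : {group gT} | (A \subset L) && P A) A>> ->
    x \in 'N(L).
  move=> nPx sLP.
  have -> : L :=: <<\bigcup_(A : {group gT} | (A \subset L) && P A) A>>.
    apply/eqP; rewrite eqEsubset sLP gen_subG.
    by apply/bigcupsP => A /andP[].
  rewrite -cycle_subG norms_gen // norms_bigcup //.
  apply/bigcapsP => A /andP[sAL PA].
  by rewrite cycle_subG nPx // (subset_trans sAL).
case/orP: triL => /andP[_ /existsP[K /and3P[nKG qnLK sLK]]];
  exists K => //; split=> // sLK'.
  apply: (norm_gen (fun A => S_quasinormally_embedded A G)).
    move=> A.
    exact: (S_quasinormally_embedded_norm p_pr q_pr neq_qp sylQ Qx pV nVx).
  by apply: subset_trans sLK; rewrite subsetI subxx.
apply: (norm_gen (fun A => tau_quasinormal A G)).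
  move=> A; apply: (tau_quasinormal_norm q_pr neq_qp sylQ Qx sVG pV nVx).
  by rewrite VxV.
by apply: subset_trans sLK; rewrite subsetI subxx.
Qed.

End Obstruction.

(** * The criterion *)

Theorem theorem3p2 (gT : finGroupType) (G : {group gT}) (p n : nat) :
  prime p -> p %| #|G| -> (1 <= n)%N ->
  coprime #|G| (\prod_(1 <= i < n.+1) (p ^ i - 1))%N ->
  p_nilpotent p G <->
  exists H : {group gT},
    [/\ H <| G,
        p_nilpotent p (G / H) &
        forall P : {group gT}, p.-Sylow(H) P ->
        forall L : {group gT}, L \subset P :&: p_nilpotent_residual p G ->
          #|L| = (p ^ n)%N \/
            [/\ p = 2%N, n = 1%N, ~~ abelian P, cyclic L & #|L| = 4%N] ->
          ~~ (L \subset hypercenter G) ->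
          has_p_nilpotent_supplement p L G \/ triangle L G].
Proof.
move=> p_pr _ n_gt0 co_Gn; split=> [nilG | [H [nHG nilGH embP]]].
  exists 1%G; split; first exact: normal1.
    apply/p_nilpotent_quotientP; first exact: normal1.
    exists 'O_p^'(G)%G; first by rewrite sub1G pcore_normal.
    move: nilG; rewrite p_nilpotent_pcore => /and3P[_ p'O].
    by rewrite pnatNK indexg1 => ->; rewrite andbT.
  move=> P /pHall_sub/trivgP P1 L; rewrite P1 subsetI => /andP[/trivgP-> _] _.
  by rewrite sub1G.
apply: contraPT isT => npG _.
have [q [U [x [q_pr neq_qp qx Gx [sUG pU nUx ncUx]]]]] :=
  not_p_nilpotent_p'elt_action p_pr npG.
have [V [sVU nVx ncVx minV]] := minimal_action_exists nUx ncUx.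
have pV := pgroupS sVU pU; have sVG := subset_trans sVU sUG.
have [Q sylQ sxQ] : {Q : {group gT} | q.-Sylow(G) Q & <[x]> \subset Q}.
  by apply: Sylow_superset; rewrite ?cycle_subG.
have Qx : x \in Q by rewrite -cycle_subG.
have p'x : p^'.-elt x by apply: sub_in_pnat qx => r _ /eqnP->; rewrite !inE.
have CVx := minimal_action_cent_Phi pV p'x nVx ncVx minV.
have iV : p ^ n < #|V : 'Phi(V)|.
  have ntX : <[x]>%G :!=: 1.
    by rewrite cycle_eq1; apply: contraNneq ncVx => ->; rewrite group1.
  have [_ q_dvx _] := pgroup_pdiv (qx : q.-group <[x]>%G) ntX.
  have q_dvG : q %| #|G| by rewrite (dvdn_trans q_dvx) // cardSg ?cycle_subG.
  rewrite -CVx.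
  apply: (pgroup_index_cent1_gt p_pr q_pr neq_qp _ pV qx nVx ncVx) => i i_bd.
  apply: (coprime_dvdr _ (coprime_dvdl q_dvG co_Gn)).
  by rewrite (bigD1_seq i) ?iota_uniq ?mem_index_iota ?dvdn_mulr.
have sVR := minimal_action_sub_residual neq_qp sylQ Qx sVG pV nVx ncVx minV.
have sVH : V \subset H.
  exact: subset_trans sVR (p_nilpotent_residual_min nHG nilGH).
have [P sylP sVP] := Sylow_superset sVH pV.
have eqV (L : {group gT}) : L \subset V -> ~~ (L \subset 'Phi(V)) ->
    #|L| = (p ^ n)%N \/
      [/\ p = 2%N, n = 1%N, ~~ abelian P, cyclic L & #|L| = 4%N] ->
    L :=: V.
  move=> sLV nLPhi oL.
  have ncLx : x \notin 'C(L).
    by apply: contra nLPhi; rewrite -CVx subsetI sLV sub_cent1.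
  have sLPR : L \subset P :&: p_nilpotent_residual p G.
    by rewrite (subset_trans sLV) // subsetI sVP.
  have nLZ : ~~ (L \subset hypercenter G).
    apply: contra ncLx.
    exact: (sub_hypercenter_cent neq_qp sylQ Qx pV nVx ncVx minV sLV).
  case: (embP P sylP L sLPR oL nLZ) => [supL | triL].
    apply: (p_nilpotent_supplement_eq neq_qp sylQ Qx sVG pV nVx ncVx minV) => //.
  by apply: (triangle_eq p_pr q_pr neq_qp sylQ Qx sVG pV nVx ncVx minV).
have oV : p ^ n < #|V|.
  by apply: leq_trans iV _; rewrite dvdn_leq ?cardG_gt0 ?dvdn_indexg.
have [a /setDP[Va nPa] pow_a] :=
  minimal_action_element p_pr pV p'x nVx ncVx minV.
have nPX (L : {group gT}) : a \in L -> ~~ (L \subset 'Phi(V)).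
  by move=> La; apply: contra nPa => /subsetP/(_ a La).
(* Otherwise <a> extends to a subgroup L of V of order p^n, and L = V would
   contradict p^n < |V|. *)
have large_a : p ^ n < #[a].
  rewrite ltnNge; apply/negP=> le_a.
  have sXV : <[a]> \subset V by rewrite cycle_subG.
  have [|L sXL [sLV oL]] := pgroup_intermediate (n := n) pV sXV.
    by rewrite -orderE le_a ltnW.
  have La : a \in L by rewrite -cycle_subG.
  by move: oV; rewrite -(eqV L sLV (nPX L La) (or_introl oL)) oL ltnn.
case: pow_a => [ap | [p2 nabV a4]].
  move: large_a; rewrite ltnNge (@leq_trans p) //.
    by rewrite dvdn_leq ?prime_gt0 // order_dvdn ap.
  by rewrite -{1}(expn1 p) leq_exp2l ?prime_gt1.
have le_a : #[a] <= 4 by rewrite dvdn_leq // order_dvdn a4.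
have n1 : n = 1%N.
  apply/eqP; rewrite eqn_leq n_gt0 andbT -ltnS -(@ltn_exp2l 2) // -{1}p2.
  exact: leq_trans large_a le_a.
have oa : #|<[a]>| = 4.
  have [k oak] : {k | #[a] = p ^ k}%N by apply/p_natP; apply: mem_p_elt Va.
  move: large_a le_a; rewrite -orderE oak p2 n1 !ltn_exp2l // (leq_exp2l _ 2) //.
  by case: k {oak} => [|[|[|k]]].
have sXV : <[a]> \subset V by rewrite cycle_subG.
case/negP: (nabV); rewrite -(eqV <[a]>%G sXV) ?cycle_abelian ?nPX ?cycle_id //.
by right; split; rewrite ?cycle_cyclic //; apply: contra nabV; apply: abelianS.
Qed.
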